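(* Every clear grand-coalition-first action model is $z$-representable by a clear single-coalition-first neighborhood model.
   Context: $AG$ is a finite nonempty set of agents, $AP$ a countable set of atomic propositions. For a nonempty set $AC$ and $C\subseteq AG$, $JA_C$ is the set of functions $\sigma_C:C\to AC$ ($JA_\emptyset=\{\emptyset\}$); $\sigma_C\subseteq\sigma_{AG}$ means $\sigma_C$ is the restriction of $\sigma_{AG}$ to $C$. A grand-coalition-first action model is $M=(ST,AC,out_{AG},L)$ with $ST,AC$ nonempty, $out_{AG}:ST\times JA_{AG}\to\mathcal P(ST)$, $L:ST\to\mathcal P(AP)$. It determines $out_C(s,\sigma_C)=\bigcup\{out_{AG}(s,\sigma_{AG})\mid\sigma_C\subseteq\sigma_{AG}\}$, $av_C(s)=\{\sigma_C\mid out_C(s,\sigma_C)\neq\emptyset\}$, and actual effectivity functions $AE_C(s)=\{out_C(s,\sigma_C)\mid\sigma_C\in av_C(s)\}$. $M$ is clear if for all $s$ and $\sigma_{AG}\neq\sigma'_{AG}$, $out_{AG}(s,\sigma_{AG})\cap out_{AG}(s,\sigma'_{AG})=\emptyset$. A single-coalition-first neighborhood model is $N=(ST,suc,\{nei_a\}_{a\in AG},L)$ with $suc:ST\to\mathcal P(ST)$ and each $nei_a(s)\subseteq\mathcal P(ST)$ a cover of $suc(s)$ (union $suc(s)$, $\emptyset\notin nei_a(s)$). With $\Delta_1\odot\Delta_2=\{Y_1\cap Y_2\mid Y_i\in\Delta_i,Y_1\cap Y_2\neq\emptyset\}$ (extended to finitely many families, $\bigodot\{\Delta\}=\Delta$):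 $nei_C(s)=\emptyset$ if $suc(s)=\emptyset$; $\{suc(s)\}$ if $suc(s)\neq\emptyset$, $C=\emptyset$; $\bigodot\{nei_a(s)\mid a\in C\}$ otherwise. $N$ is clear if for all $a,s$, $nei_a(s)$ is a partition of $suc(s)$ (cover with pairwise disjoint distinct members). $M$ is $z$-representable by $N$ if they share $ST$ and $L$ and $AE_C=nei_C$ for all $C\subseteq AG$. *)

(* Defs.v *)
From mathcomp Require Import all_boot.
From mathcomp Require Import boolp classical_sets.

Set Implicit Arguments.
Unset Strict Implicit.
Unset Printing Implicit Defensive.

Local Open Scope classical_set_scope.

(* Coalitions are finite sets C : {set AG}; sets of states, and families of
   these, are classical sets. *)
Definition JA (AG : finType) (AC : Type) (C : {set AG}) : Type :=
  {a : AG | a \in C} -> AC.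

Definition restrict (AG : finType) (AC : Type) (C : {set AG})
    (sigma : JA AC [set: AG]%SET) : JA AC C :=
  fun a => sigma (exist _ (val a) (finset.in_setT (val a))).
Arguments restrict {AG AC} C sigma a.

Section ActionModels.
Variables (AG : finType) (AP : countType).

(* The set of states is a parameter, so that "sharing ST" is sharing it. *)
Record action_model (ST : Type) := ActionModel {
  action_ST_nonempty : inhabited ST;
  AC : Type;
  AC_nonempty : inhabited AC;
  outAG : ST -> JA AC [set: AG]%SET -> set ST;
  action_label : ST -> set AP }.

Variables (ST : Type) (M : action_model ST).

Definition out (C : {set AG}) (s : ST) (sigma : JA (AC M) C) : set ST :=
  \bigcup_(tau in [set tau | restrict C tau = sigma]) outAG s tau.

Definition av (C : {set AG}) (s : ST) : set (JA (AC M) C) :=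
  [set sigma | out s sigma !=set0].
Arguments av : clear implicits.

Definition AE (C : {set AG}) (s : ST) : set (set ST) :=
  [set out s sigma | sigma in av C s].

Definition clear_action_model : Prop :=
  forall (s : ST) (sigma tau : JA (AC M) [set: AG]%SET),
    sigma <> tau -> outAG s sigma `&` outAG s tau = set0.

End ActionModels.

Section NeighborhoodModels.
Variables (AG : finType) (AP : countType).

Definition is_cover (T : Type) (D : set (set T)) (A : set T) : Prop :=
  cover D id = A /\ ~ D set0.

Record neighborhood_model (ST : Type) := NeighborhoodModel {
  neighborhood_ST_nonempty : inhabited ST;
  suc : ST -> set ST;
  nei1 : AG -> ST -> set (set ST);
  nei1_cover : forall (a : AG) (s : ST), is_cover (nei1 a s) (suc s);
  neighborhood_label : ST -> set AP }.

Definition odot (T : Type) (D1 D2 : set (set T)) : set (set T) :=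
  [set Y | exists Y1 Y2 : set T,
    [/\ D1 Y1, D2 Y2, Y1 `&` Y2 !=set0 & Y = Y1 `&` Y2]].

(* odot is associative and commutative, so the order of the list is
   immaterial; the list is D :: Ds, so that bigodot D [::] = D. *)
Definition bigodot (T : Type) (D : set (set T)) (Ds : seq (set (set T))) :
    set (set T) :=
  foldl (@odot T) D Ds.

Variables (ST : Type) (N : neighborhood_model ST).

(* The combination ranges over the family (nei_a(s)) indexed by a \in C: agents
   with equal neighborhood families are not merged. The last branch is the
   empty coalition. *)
Definition nei (C : {set AG}) (s : ST) : set (set ST) :=
  if `[< suc N s = set0 >] then set0
  else if enum C is a :: l then
    bigodot (nei1 N a s) [seq nei1 N b s | b <- l]
  else [set suc N s].

Definition clear_neighborhood_model : Prop :=
  forall (a : AG) (s : ST), partition (nei1 N a s) id (suc N s).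

End NeighborhoodModels.

Definition z_representable (AG : finType) (AP : countType) (ST : Type)
    (M : action_model AG AP ST) (N : neighborhood_model AG AP ST) : Prop :=
  action_label M = neighborhood_label N /\
  forall C : {set AG}, AE M C = nei N C.

(* Main.v *)
(** For a clear model, a state reachable from [s] is reachable through exactly one
    joint action of the grand coalition. So [out_C(s, sigma_C)] consists of the
    reachable states whose joint action restricts to [sigma_C], and the family
    [AE_C(s)] splits the reachable states by the [C]-part of their joint action.
    Hence each [AE_C(s)] is a partition, and [AE_(A u B)] is the combination of
    [AE_A] and [AE_B]; taking [nei_a = AE_{a}] gives [nei_C = AE_C] for all [C]. *)

From mathcomp Require Import all_boot.
From mathcomp Require Import boolp classical_sets.
Require Import Defs.

Set Implicit Arguments.
Unset Strict Implicit.
Unset Printing Implicit Defensive.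

Local Open Scope classical_set_scope.

Lemma restrict_eqP (AG : finType) (AC : Type) (C : {set AG})
    (sigma tau : JA AC [set: AG]%SET) :
  restrict C sigma = restrict C tau <->
  forall a, a \in C -> sigma (exist _ a (finset.in_setT a)) =
                       tau (exist _ a (finset.in_setT a)).
Proof.
split=> [eqC a aC | eqC]; first exact: (congr1 (@^~ (exist _ a aC)) eqC).
by apply/funext => -[a aC]; exact: eqC.
Qed.

Lemma restrict_setU (AG : finType) (AC : Type) (A B : {set AG})
    (sigma tau : JA AC [set: AG]%SET) :
  restrict (A :|: B) sigma = restrict (A :|: B) tau <->
  restrict A sigma = restrict A tau /\ restrict B sigma = restrict B tau.
Proof.
rewrite !restrict_eqP; split=> [eqAB | [eqA eqB] a].
  by split=> a aC; apply: eqAB; rewrite finset.in_setU aC ?orbT.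
by rewrite finset.in_setU => /orP[/eqA | /eqB].
Qed.

Lemma restrict_set0 (AG : finType) (AC : Type)
    (sigma tau : JA AC [set: AG]%SET) :
  restrict finset.set0 sigma = restrict finset.set0 tau.
Proof. by apply/restrict_eqP => a; rewrite finset.in_set0. Qed.

Section ActionModel.
Variables (AG : finType) (AP : countType) (ST : Type).
Variable M : action_model AG AP ST.
Implicit Types (A B C : {set AG}) (s t : ST).

(** This serves as [suc] in the neighborhood model built at the end. *)
Definition successors s : set ST := \bigcup_tau @outAG _ _ _ M s tau.

Lemma outAG_sub_out C s (tau : JA (AC M) [set: AG]%SET) :
  outAG s tau `<=` out s (restrict C tau).
Proof. by move=> t st; exists tau. Qed.

(** A state in [out s sigma] is reached by a joint action of all agents that extends [sigma]. So the
    available actions of [C] are the restrictions of grand-coalition actions with an outcome, and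
    [AE] can be indexed by the latter. *)
Lemma AE_restrict C s :
  AE M C s =
  [set out s (restrict C tau) | tau in [set tau | outAG (a:=M) s tau !=set0]].
Proof.
apply/seteqP; split=> Y /=.
  by move=> [_ [t [tau <- st]] <-]; exists tau => //; exists t.
move=> [tau [t st] <-]; exists (restrict C tau) => //.
by exists t; exact: outAG_sub_out.
Qed.

Lemma AE_neq0 C s Y : AE M C s Y -> Y !=set0.
Proof. by move=> [sigma sigma_av <-]. Qed.

Lemma cover_AE C s : cover (AE M C s) id = successors s.
Proof.
rewrite AE_restrict; apply/seteqP; split=> t.
  by move=> [_ [tau _ <-] [rho _ st]]; exists rho.
move=> [tau _ st]; exists (out s (restrict C tau)); last exact: outAG_sub_out.
by exists tau => //; exists t.
Qed.

Lemma AE_is_cover C s : is_cover (AE M C s) (successors s).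
Proof. by split=> [|/AE_neq0[]//]; exact: cover_AE. Qed.

Lemma AE_successors0 C s : successors s = set0 -> AE M C s = set0.
Proof.
move=> suc0; rewrite AE_restrict -subset0 => Y [tau [t st] _].
by have : successors s t by [exists tau]; rewrite suc0.
Qed.

(** All joint actions have the same restriction to the empty coalition, so its only outcome set is
    the union of all outcomes; a successor makes its action available. *)
Lemma AE_set0 s : successors s <> set0 -> AE M finset.set0 s = [set successors s].
Proof.
have outE (tau : JA (AC M) [set: AG]%SET) :
    out s (restrict finset.set0 tau) = successors s.
  apply/seteqP; split=> t [rho _ st]; exists rho => //.
  exact: restrict_set0.
move=> /eqP/set0P[t [tau _ st]]; rewrite AE_restrict; apply/seteqP; split=> Y /=.
  by move=> [rho _ <-].
by move=> ->; exists tau => //; exists t.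
Qed.

Hypothesis M_clear : clear_action_model M.

Lemma outAG_inj s t (sigma tau : JA (AC M) [set: AG]%SET) :
  outAG s sigma t -> outAG s tau t -> sigma = tau.
Proof.
move=> ss st; apply: contrapT => /(M_clear s) disj.
by have : (outAG s sigma `&` outAG s tau) t by []; rewrite disj.
Qed.

(** For the inclusion from right to left, a common state is reached by some [rho] agreeing with
    [tau] on [A] and some [rho'] agreeing with [tau] on [B]. Clearness gives [rho = rho'], which
    then agrees with [tau] on the union. *)
Lemma out_restrict_setU A B s (tau : JA (AC M) [set: AG]%SET) :
  out s (restrict (A :|: B) tau) =
  out s (restrict A tau) `&` out s (restrict B tau).
Proof.
apply/seteqP; split=> t.
  by move=> [rho /restrict_setU[eqA eqB] st]; split; exists rho.
move=> [[rho eqA st] [rho' eqB st']]; exists rho => //.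
apply/restrict_setU; split=> //.
by rewrite (outAG_inj st st').
Qed.

Lemma AE_partition C s : partition (AE M C s) id (successors s).
Proof.
split; [exact: cover_AE | | by move=> Y /AE_neq0].
(* A state [t] common to two members has a single joint action, whose restriction to [C] indexes
   both. *)
move=> _ _ [sigma _ <-] [tau _ <-] [t [[rho <- st] [rho' <- st']]].
by rewrite (outAG_inj st st').
Qed.

Lemma odot_AE A B s : odot (AE M A s) (AE M B s) = AE M (A :|: B) s.
Proof.
rewrite !AE_restrict; apply/seteqP; split=> Y.
  (* Here [sigma] and [tau] may be incompatible on the overlap of [A] and [B] a priori; the joint
     action [rho] reaching a common state [t] replaces both. *)
  move=> [_ [_ [[sigma _ <-] [tau _ <-] [t [[rho <- st] [rho' <- st']]] ->]]].
  rewrite -(outAG_inj st st').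
  by exists rho; [exists t | rewrite out_restrict_setU].
move=> [tau [t st] <-].
exists (out s (restrict A tau)), (out s (restrict B tau)); split.
- by exists tau => //; exists t.
- by exists tau => //; exists t.
- by exists t; split; exact: outAG_sub_out.
- exact: out_restrict_setU.
Qed.

(** The coalition [A] is arbitrary because it is the accumulator of the left fold: each step
    enlarges it by one agent, by [odot_AE]. *)
Lemma bigodot_AE A s (l : seq AG) :
  bigodot (AE M A s) [seq AE M (finset.set1 b) s | b <- l] =
  AE M (A :|: [set b in l]%SET) s.
Proof.
rewrite /bigodot; elim: l A => [|b l IHl] A /=.
  by congr (AE M _ s); apply/setP => x; rewrite !finset.inE orbF.
rewrite odot_AE IHl; congr (AE M _ s).
by apply/setP => x; rewrite !finset.inE orbA.
Qed.

End ActionModel.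

Theorem theorem5p7 (AG : finType) (AG_nonempty : 0 < #|AG|) (AP : countType)
    (ST : Type) (M : action_model AG AP ST) :
  clear_action_model M ->
  exists N : neighborhood_model AG AP ST,
    clear_neighborhood_model N /\ z_representable M N.
Proof.
move=> M_clear.
exists (NeighborhoodModel (action_ST_nonempty M)
  (fun a s => AE_is_cover M (finset.set1 a) s) (action_label M)).
split=> [a s|]; first exact: AE_partition.
split=> // C; apply/funext => s; rewrite /nei /=.
case: asboolP => [|suc_neq0]; first exact: AE_successors0.
case enumC: (enum C) => [|a l].
  have -> : C = finset.set0.
    by apply/setP => x; rewrite -mem_enum enumC finset.in_set0.
  exact: AE_set0.
(* The fold starts from the family of the singleton of [a], so the coalition obtained is that of the
   agents in [a :: l], which enumerates [C]. *)
rewrite bigodot_AE //; congr (AE M _ s).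
by apply/setP => x; rewrite -mem_enum enumC !finset.inE.
Qed.
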